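(* Let $SP=\{Pre\}(\mathcal{R},s)\{Post\}$ be an annotated specification, i.e. $Pre$ and $Post$ are formulas, $\mathcal{R}$ is a logically decorated graph rewriting system and $s$ is an annotated strategy over $\mathcal{R}$. If the formula $correct(SP)=(Pre\Rightarrow wp(s,Post))\wedge vc(s,Post)$ is valid (satisfied by every graph), then for all graphs $G$, $G'$ such that $G\Rightarrow_s G'$, $G\models Pre$ implies $G'\models Post$.
   Context: Fix a logic $\mathcal{L}$. A logically decorated graph over $(\mathcal{C},\mathcal{R})$, $\mathcal{C},\mathcal{R}\subseteq\mathcal{L}$, with basic concepts $\mathcal{C}_0\subseteq\mathcal{C}$ and basic roles $\mathcal{R}_0\subseteq\mathcal{R}$, is $G=(N,E,\Phi_N,\Phi_E,s,t)$ with $\Phi_N:N\to\mathcal{P}(\mathcal{C})$, $\Phi_E:E\to\mathcal{R}$, $s,t:E\to N$. Elementary actions and their effect $G[a]$: $add_N(i)$ adds a fresh node $i$ with no edges and empty label; $del_N(i)$ removes $i$ and all edges incident to it; $add_C(i,c)$ ($c\in\mathcal{C}_0$) adds $c$ to $\Phi_N(i)$; $del_C(i,c)$ removes $c$ from $\Phi_N(i)$; $add_E(e,i,j,r)$ ($r\in\mathcal{R}_0$) adds a fresh edge $e$ from $i$ to $j$ labelled $r$; $del_E(e,i,j,r)$ removes edge $e$; $i\gg j$ makes every edge with target $i$ have target $j$; $mrg(i,j)$ deletes node $j$, sets $\Phi_N(i):=\Phi_N(i)\cup\Phi_N(j)$, and replaces $j$ by $i$ as source/target of every edge; $cl(i,j,R_{in},R_{out},R_{lin},R_{lout},R_{ll})$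 (parameters are subsets of $\mathcal{R}_0$) adds a new node $j$ with $\Phi_N(j)=\Phi_N(i)\cap\mathcal{C}_0$ and, with the same label as the original edge $e$: a fresh edge $s(e)\to j$ for every non-loop $e$ with target $i$ and label in $R_{in}$; a fresh edge $j\to t(e)$ for every non-loop $e$ with source $i$ and label in $R_{out}$; for every loop $e$ at $i$, a fresh edge $i\to j$ if its label is in $R_{lin}$, a fresh edge $j\to i$ if in $R_{lout}$, a fresh loop at $j$ if in $R_{ll}$. An action is a sequence $a_1;\dots;a_n$ with $G[a;\alpha]=(G[a])[\alpha]$, $G[\epsilon]=G$. A rule is $\rho=(L,\alpha_\rho)$ with $L$ a logically decorated graph and $\alpha_\rho$ an action over node names of $L$; a rewriting system $\mathcal{R}$ is a set of rules. A match from $L$ to $G$ is $h=(h^N,h^E)$, $h^N:N^L\to N^G$, $h^E:E^L\to E^G$, such that every $h^N(n)$ satisfies every formula in $\Phi_N^L(n)$, $\Phi_E^G(h^E(e))=\Phi_E^L(e)$, $s^G(h^E(e))=h^N(s^L(e))$ and $t^G(h^E(e))=h^N(t^L(e))$. $G\to_\rho G'$ iff there is a match $h$ and $G'=G[h(\alpha_\rho)]$ ($h(\alpha_\rho)$ replaces node names $n$ of $L$ by $h^N(n)$). Strategies: $s::=\epsilon\mid\rho\mid s\oplus s\mid s;s\mid s^*\mid\rho?\mid\rho!$ ($\rho\in\mathcal{R}$); in an annotated strategy every $s^*$ carries an invariant formula $inv_s$. $G\models App(\rho)$ and $G\models App(\rho!)$ iff there is a match from the left-hand side of $\rho$ to $G$;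 $App(\epsilon)$, $App(s^* )$, $App(\rho?)$ always hold; $App(s_0\oplus s_1)$ iff $App(s_0)$ or $App(s_1)$; $App(s_0;s_1)$ iff $App(s_0)$. The relation $G\Rightarrow_s G'$ is the least one given by: $G\Rightarrow_\epsilon G$; $G\Rightarrow_{s_0;s_1}G'$ if $G\Rightarrow_{s_0}G''$ and $G''\Rightarrow_{s_1}G'$; $G\Rightarrow_{s_0\oplus s_1}G'$ if $G\Rightarrow_{s_0}G'$ or $G\Rightarrow_{s_1}G'$; $G\Rightarrow_{s^*}G$ if $G\not\models App(s)$; $G\Rightarrow_{s^*}G'$ if $G\models App(s)$, $G\Rightarrow_s G''$ and $G''\Rightarrow_{s^*}G'$; for $\rho$, $\rho!$, $\rho?$: $G\Rightarrow G'$ if $G\models App(\rho)$ and $G\to_\rho G'$; if $G\not\models App(\rho)$ then $G\Rightarrow_\rho\top$ where $\top$ is a special successful-termination outcome (not a graph), $\rho!$ has no result (failure), and $G\Rightarrow_{\rho?}G$. Formulas: formulas of $\mathcal{L}$ closed under $\neg,\wedge,\vee,\Rightarrow$, together with atoms $App(s)$ and substitution formulas $\phi[a]$ with $G\models\phi[a]$ iff $G[a]\models\phi$ (formulas may mention the node names used in rules). Weakest preconditions: $wp(a,Q)=Q[a]$, $wp(a;\alpha,Q)=wp(a,wp(\alpha,Q))$; $wp(\epsilon,Q)=Q$; $wp(s_0;s_1,Q)=wp(s_0,wp(s_1,Q))$; $wp(s_0\oplus s_1,Q)=wp(s_0,Q)\wedge wp(s_1,Q)$; $wp(s^*\{inv_s\},Q)=inv_s$;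 $wp(\rho,Q)=App(\rho)\Rightarrow wp(\alpha_\rho,Q)$; $wp(\rho!,Q)=App(\rho)\wedge wp(\alpha_\rho,Q)$; $wp(\rho?,Q)=(App(\rho)\Rightarrow wp(\alpha_\rho,Q))\wedge(\neg App(\rho)\Rightarrow Q)$. Verification conditions: $vc(\epsilon,Q)=vc(\rho,Q)=vc(\rho!,Q)=vc(\rho?,Q)=\top$ (true); $vc(s_0;s_1,Q)=vc(s_0,wp(s_1,Q))\wedge vc(s_1,Q)$; $vc(s_0\oplus s_1,Q)=vc(s_0,Q)\wedge vc(s_1,Q)$; $vc(s^*\{inv_s\},Q)=vc(s,inv_s)\wedge(inv_s\wedge App(s)\Rightarrow wp(s,inv_s))\wedge(inv_s\wedge\neg App(s)\Rightarrow Q)$.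
   Formalization: In wp of ρ, ρ! and ρ?, the part wp(α_ρ,Q) is required for every match h of ρ, with the node and edge names of the left-hand side denoting their images under h; graphs carry the current denotation of names. Without this the formula is undefined, or unsound if names are fixed nodes. *)

(* Defs.v *)
From mathcomp Require Import all_boot boolp classical_sets.

Set Implicit Arguments.
Unset Strict Implicit.
Unset Printing Implicit Defensive.

Local Open Scope classical_set_scope.

(* Node and edge names are identifiers; they are what actions, and possibly
   formulas, use to speak about nodes and edges. *)
Record signature := Signature {
  node_name : Type;
  edge_name : Type;
  lform : Type;
  concept : set lform;
  role : set lform;
  basic_concept : set concept;
  basic_role : set role
}.
Arguments concept : clear implicits.
Arguments role : clear implicits.
Arguments basic_concept : clear implicits.
Arguments basic_role : clear implicits.

Record lgraph (S : signature) := LGraph {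
  node : Type;
  edge : Type;
  node_lbl : node -> set (concept S);
  edge_lbl : edge -> role S;
  src : edge -> node;
  tgt : edge -> node
}.

(* A graph together with what the names currently denote: [None] for a name
   that denotes nothing.  All graphs below are of this kind, so that actions
   and formulas containing names can be interpreted in them. *)
Record graph (S : signature) := Graph {
  carrier :> lgraph S;
  node_of : node_name S -> option (node carrier);
  edge_of : edge_name S -> option (edge carrier)
}.

(* An arbitrary logic: satisfaction of a formula by a graph, and of a concept
   by a node of a graph. *)
Record logic := Logic {
  sig :> signature;
  lsat : graph sig -> lform sig -> Prop;
  nsat : forall G : graph sig, node G -> concept sig -> Prop
}.

Section Actions.
Variable S : signature.
Implicit Types G : graph S.

Inductive elementary :=
| add_N (i : node_name S)
| del_N (i : node_name S)
| add_C (i : node_name S) (c : basic_concept S)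
| del_C (i : node_name S) (c : basic_concept S)
| add_E (e : edge_name S) (i j : node_name S) (r : basic_role S)
| del_E (e : edge_name S) (i j : node_name S) (r : role S)
| redirect (i j : node_name S)
| mrg (i j : node_name S)
| cl (i j : node_name S) (Rin Rout Rlin Rlout Rll : set (basic_role S)).

Definition action := seq elementary.

(* Changing what one name denotes. *)
Definition upd (X Y : Type) (f : X -> option Y) (x : X) (y : Y) :
    X -> option Y :=
  fun z => if `[< z = x >] then Some y else f z.

(* A fresh node or edge is the [None] of an option type; the old ones are
   the [Some _]. *)
Definition add_node G (x : node_name S) : graph S :=
  @Graph S
    (@LGraph S (option (node G)) (edge G)
       (fun n => if n is Some m then node_lbl m else set0)
       (@edge_lbl S G)
       (fun e => Some (src e)) (fun e => Some (tgt e)))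
    (upd (fun z => omap Some (node_of G z)) x None)
    (@edge_of S G).

Section DelNode.
Variables (G : graph S) (i : node G).

Let kept_node : set (node G) := [set n | n <> i].
Let kept_edge : set (edge G) := [set e | src e <> i /\ tgt e <> i].

Definition del_node : graph S :=
  @Graph S
    (@LGraph S kept_node kept_edge
       (fun n => node_lbl (val n)) (fun e => edge_lbl (val e))
       (fun e => SigSub (mem_set (proj1 (set_valP e) : kept_node (src (val e)))))
       (fun e => SigSub (mem_set (proj2 (set_valP e) : kept_node (tgt (val e))))))
    (fun z => obind insub (node_of G z))
    (fun z => obind insub (edge_of G z)).
End DelNode.

Definition relabel G (i : node G) (l : set (concept S)) : graph S :=
  @Graph S
    (@LGraph S (node G) (edge G)
       (fun n => if `[< n = i >] then l else node_lbl n)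
       (@edge_lbl S G) (@src S G) (@tgt S G))
    (@node_of S G) (@edge_of S G).

Definition add_edge G (x : edge_name S) (i j : node G) (r : role S) : graph S :=
  @Graph S
    (@LGraph S (node G) (option (edge G)) (@node_lbl S G)
       (fun e => if e is Some f then edge_lbl f else r)
       (fun e => if e is Some f then src f else i)
       (fun e => if e is Some f then tgt f else j))
    (@node_of S G)
    (upd (fun z => omap Some (edge_of G z)) x None).

Definition del_edge G (e : edge G) : graph S :=
  let kept : set (edge G) := [set f | f <> e] in
  @Graph S
    (@LGraph S (node G) kept (@node_lbl S G)
       (fun f => edge_lbl (val f))
       (fun f => src (val f)) (fun f => tgt (val f)))
    (@node_of S G)
    (fun z => obind insub (edge_of G z)).

Definition redirect_edges G (i j : node G) : graph S :=
  @Graph S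
    (@LGraph S (node G) (edge G) (@node_lbl S G) (@edge_lbl S G) (@src S G)
       (fun e => if `[< tgt e = i >] then j else tgt e))
    (@node_of S G) (@edge_of S G).

Section Merge.
Variables (G : graph S) (i j : node G) (neq_ij : i <> j).

Let kept_node : set (node G) := [set n | n <> j].
Let keep_i : kept_node := SigSub (mem_set (neq_ij : kept_node i)).

(* [insubd keep_i n] is [i] when [n] is [j], and [n] otherwise. *)
Definition merge : graph S :=
  @Graph S
    (@LGraph S kept_node (edge G)
       (fun n => if `[< val n = i >] then node_lbl i `|` node_lbl j
                 else node_lbl (val n))
       (@edge_lbl S G)
       (fun e => insubd keep_i (src e))
       (fun e => insubd keep_i (tgt e)))
    (fun z => obind insub (node_of G z))
    (@edge_of S G).
End Merge.

Section Clone.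
Variables (G : graph S) (i : node G).
Variables Rin Rout Rlin Rlout Rll : set (basic_role S).

Let has_lbl (R : set (basic_role S)) (e : edge G) : Prop :=
  exists2 r, R r & edge_lbl e = val r.
Let is_loop (e : edge G) : Prop := src e = i /\ tgt e = i.
Let in_edge : set (edge G) :=
  [set e | [/\ tgt e = i, src e <> i & has_lbl Rin e]].
Let out_edge : set (edge G) :=
  [set e | [/\ src e = i, tgt e <> i & has_lbl Rout e]].
Let lin_edge : set (edge G) := [set e | is_loop e /\ has_lbl Rlin e].
Let lout_edge : set (edge G) := [set e | is_loop e /\ has_lbl Rlout e].
Let ll_edge : set (edge G) := [set e | is_loop e /\ has_lbl Rll e].

Inductive clone_edge : Type :=
| old_edge of edge G
| copy_in of in_edge
| copy_out of out_edge
| copy_lin of lin_edge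
| copy_lout of lout_edge
| copy_ll of ll_edge.

Definition clone_origin (e : clone_edge) : edge G :=
  match e with
  | old_edge f => f
  | copy_in f => val f
  | copy_out f => val f
  | copy_lin f => val f
  | copy_lout f => val f
  | copy_ll f => val f
  end.

Definition clone_src (e : clone_edge) : option (node G) :=
  match e with
  | old_edge f => Some (src f)
  | copy_in f => Some (src (val f))
  | copy_out _ => None
  | copy_lin _ => Some i
  | copy_lout _ => None
  | copy_ll _ => None
  end.

Definition clone_tgt (e : clone_edge) : option (node G) :=
  match e with
  | old_edge f => Some (tgt f)
  | copy_in _ => None
  | copy_out f => Some (tgt (val f))
  | copy_lin _ => None
  | copy_lout _ => Some i
  | copy_ll _ => None
  end.

Definition clone (x : node_name S) : graph S :=
  @Graph S
    (@LGraph S (option (node G)) clone_edge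
       (fun n => if n is Some m then node_lbl m
                 else node_lbl i `&` basic_concept S)
       (fun e => edge_lbl (clone_origin e))
       clone_src clone_tgt)
    (upd (fun z => omap Some (node_of G z)) x None)
    (fun z => omap old_edge (edge_of G z)).
End Clone.

(* G[a].  An action on a name that denotes nothing has no effect, and neither
   has merging a node with itself (two names may denote the same node). *)
Definition apply1 G (a : elementary) : graph S :=
  match a with
  | add_N x => add_node G x
  | del_N x => if node_of G x is Some i then del_node i else G
  | add_C x c =>
      if node_of G x is Some i then relabel i (node_lbl i `|` [set val c])
      else G
  | del_C x c =>
      if node_of G x is Some i then relabel i (node_lbl i `\` [set val c])
      else G
  | add_E e x y r =>
      match node_of G x, node_of G y with
      | Some i, Some j => add_edge e i j (val r)
      | _, _ => G
      end
  | del_E e _ _ _ => if edge_of G e is Some f then del_edge f else G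
  | redirect x y =>
      match node_of G x, node_of G y with
      | Some i, Some j => redirect_edges i j
      | _, _ => G
      end
  | mrg x y =>
      match node_of G x, node_of G y with
      | Some i, Some j =>
          match pselect (i = j) with
          | left _ => G
          | right neq_ij => merge neq_ij
          end
      | _, _ => G
      end
  | cl x y Rin Rout Rlin Rlout Rll =>
      if node_of G x is Some i then clone i Rin Rout Rlin Rlout Rll y else G
  end.

Definition apply G (alpha : action) : graph S := foldl apply1 G alpha.

(* The names used by an action are among those in X and Y or have been
   introduced by an earlier add_N, add_E or cl of the same action. *)
Fixpoint over (X : set (node_name S)) (Y : set (edge_name S))
    (alpha : action) : Prop :=
  match alpha with
  | [::] => True
  | add_N i :: alpha' => over (i |` X) Y alpha'
  | del_N i :: alpha' => X i /\ over X Y alpha'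
  | add_C i _ :: alpha' => X i /\ over X Y alpha'
  | del_C i _ :: alpha' => X i /\ over X Y alpha'
  | add_E e i j _ :: alpha' => [/\ X i, X j & over X (e |` Y) alpha']
  | del_E e i j _ :: alpha' => [/\ Y e, X i, X j & over X Y alpha']
  | redirect i j :: alpha' => [/\ X i, X j & over X Y alpha']
  | mrg i j :: alpha' => [/\ X i, X j & over X Y alpha']
  | cl i j _ _ _ _ _ :: alpha' => X i /\ over (j |` X) Y alpha'
  end.

Record rule := Rule {
  lhs : graph S;
  act : action;
  act_over : over [set x | node_of lhs x] [set e | edge_of lhs e] act
}.

(* G in which every name of L denotes the image under h of what it denotes
   in L, the other names being unaffected.  Hence G[h(alpha)] is
   [apply (bind G hN hE) alpha]. *)
Definition bind (L G : graph S) (hN : node L -> node G)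
    (hE : edge L -> edge G) : graph S :=
  @Graph S (carrier G)
    (fun x => if node_of L x is Some n then Some (hN n) else node_of G x)
    (fun x => if edge_of L x is Some e then Some (hE e) else edge_of G x).

End Actions.

Section Matches.
Variable L : logic.

(* The names of K that may occur in its labels stand for nodes of K, hence
   satisfaction is taken in [bind G hN hE], which is G for name-free labels. *)
Definition is_match (K G : graph L) (hN : node K -> node G)
    (hE : edge K -> edge G) : Prop :=
  [/\ forall n c, node_lbl n c -> @nsat L (bind hN hE) (hN n) c,
      forall e, edge_lbl (hE e) = edge_lbl e,
      forall e, src (hE e) = hN (src e)
    & forall e, tgt (hE e) = hN (tgt e)].

Definition has_match (K G : graph L) : Prop :=
  exists hN hE, @is_match K G hN hE.

Definition step (rho : rule L) (G G' : graph L) : Prop :=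
  exists hN hE, @is_match (lhs rho) G hN hE /\ G' = apply (bind hN hE) (act rho).

End Matches.

Section Strategies.
Variables (L : logic) (RS : rule L -> Prop).

(* [FMatch rho phi] states phi with the names of the left-hand side of rho
   denoting the nodes (and edges) selected by a match, whichever match it is.
   It delimits, in wp(rho, Q), the scope of the node names of rho used by its
   action: these stand for h(n), where h is the match the rule is fired with. *)
Inductive formula :=
| FBase (p : lform L)
| FTrue
| FNot (phi : formula)
| FAnd (phi psi : formula)
| FOr (phi psi : formula)
| FImp (phi psi : formula)
| FApp (s : strategy)
| FSub (phi : formula) (a : elementary L)
| FMatch (rho : {r | RS r}) (phi : formula)
with strategy :=
| SEps
| SRule (rho : {r | RS r})
| SChoice (s0 s1 : strategy)
| SSeq (s0 s1 : strategy)
| SStar (s : strategy) (inv : formula)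
| STry (rho : {r | RS r})    (* rho? *)
| SMust (rho : {r | RS r}).  (* rho! *)

Fixpoint app (G : graph L) (s : strategy) : Prop :=
  match s with
  | SRule rho | SMust rho => has_match (lhs (sval rho)) G
  | SEps | SStar _ _ | STry _ => True
  | SChoice s0 s1 => app G s0 \/ app G s1
  | SSeq s0 _ => app G s0
  end.

Fixpoint sat (G : graph L) (phi : formula) : Prop :=
  match phi with
  | FBase p => lsat G p
  | FTrue => True
  | FNot phi => ~ sat G phi
  | FAnd phi psi => sat G phi /\ sat G psi
  | FOr phi psi => sat G phi \/ sat G psi
  | FImp phi psi => sat G phi -> sat G psi
  | FApp s => app G s
  | FSub phi a => sat (apply1 G a) phi
  | FMatch rho phi =>
      forall hN hE, @is_match L (lhs (sval rho)) G hN hE -> sat (bind hN hE) phi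
  end.

Definition valid (phi : formula) : Prop := forall G, sat G phi.

Inductive outcome := OGraph of graph L | OTop.

Inductive exec : strategy -> graph L -> outcome -> Prop :=
| exec_eps G : exec SEps G (OGraph G)
| exec_seq s0 s1 G G1 o :
    exec s0 G (OGraph G1) -> exec s1 G1 o -> exec (SSeq s0 s1) G o
| exec_choicel s0 s1 G o : exec s0 G o -> exec (SChoice s0 s1) G o
| exec_choicer s0 s1 G o : exec s1 G o -> exec (SChoice s0 s1) G o
| exec_star_stop s inv G : ~ app G s -> exec (SStar s inv) G (OGraph G)
| exec_star_step s inv G G1 o :
    app G s -> exec s G (OGraph G1) -> exec (SStar s inv) G1 o ->
    exec (SStar s inv) G o
| exec_rule rho G G' :
    app G (SRule rho) -> step (sval rho) G G' -> exec (SRule rho) G (OGraph G')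
| exec_rule_top rho G : ~ app G (SRule rho) -> exec (SRule rho) G OTop
| exec_must rho G G' :
    app G (SRule rho) -> step (sval rho) G G' -> exec (SMust rho) G (OGraph G')
| exec_try rho G G' :
    app G (SRule rho) -> step (sval rho) G G' -> exec (STry rho) G (OGraph G')
| exec_try_skip rho G : ~ app G (SRule rho) -> exec (STry rho) G (OGraph G).

Fixpoint wp_act (alpha : action L) (Q : formula) : formula :=
  if alpha is a :: alpha' then FSub (wp_act alpha' Q) a else Q.

Definition wp_fire (rho : {r | RS r}) (Q : formula) : formula :=
  FMatch rho (wp_act (act (sval rho)) Q).

Fixpoint wp (s : strategy) (Q : formula) : formula :=
  match s with
  | SEps => Q
  | SSeq s0 s1 => wp s0 (wp s1 Q)
  | SChoice s0 s1 => FAnd (wp s0 Q) (wp s1 Q)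
  | SStar _ inv => inv
  | SRule rho => FImp (FApp (SRule rho)) (wp_fire rho Q)
  | SMust rho => FAnd (FApp (SRule rho)) (wp_fire rho Q)
  | STry rho => FAnd (FImp (FApp (SRule rho)) (wp_fire rho Q))
                     (FImp (FNot (FApp (SRule rho))) Q)
  end.

Fixpoint vc (s : strategy) (Q : formula) : formula :=
  match s with
  | SEps | SRule _ | SMust _ | STry _ => FTrue
  | SSeq s0 s1 => FAnd (vc s0 (wp s1 Q)) (vc s1 Q)
  | SChoice s0 s1 => FAnd (vc s0 Q) (vc s1 Q)
  | SStar s inv =>
      FAnd (vc s inv)
        (FAnd (FImp (FAnd inv (FApp s)) (wp s inv))
              (FImp (FAnd inv (FNot (FApp s))) Q))
  end.

End Strategies.

Record specification (L : logic) := Specification {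
  rules : rule L -> Prop;
  pre : formula rules;
  strat : strategy rules;
  post : formula rules
}.

Definition correct (L : logic) (SP : specification L) : formula (rules SP) :=
  FAnd (FImp (pre SP) (wp (strat SP) (post SP))) (vc (strat SP) (post SP)).

(* Main.v *)
Require Import Defs.
From mathcomp Require Import all_boot.

(** Induction on the derivation of [exec], not on the strategy, since a loop re-runs itself; [Q]
    stays general because [wp] changes it at sequences and loops. Rule firings reduce to
    [sat_wp_fire]. *)

Lemma sat_wp_act (L : logic) (RS : rule L -> Prop) (alpha : action L)
    (Q : formula RS) (G : graph L) :
  sat G (wp_act alpha Q) <-> sat (apply G alpha) Q.
Proof. by elim: alpha G => [|a alpha IH] G //=; apply: IH. Qed.

(** [FMatch] covers every match, in particular the one fired. *)
Lemma sat_wp_fire (L : logic) (RS : rule L -> Prop) (rho : {r | RS r})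
    (Q : formula RS) (G G' : graph L) :
  step (sval rho) G G' -> sat G (wp_fire rho Q) -> sat G' Q.
Proof. by move=> [hN [hE [hm ->]]] /(_ hN hE hm)/sat_wp_act. Qed.

(* The verification conditions are assumed at every graph, not just at [G],
   since those of a loop are used at each intermediate graph. *)
Lemma sat_wp_exec (L : logic) (RS : rule L -> Prop) (s : strategy RS)
    (G : graph L) (o : outcome L) :
  exec s G o -> forall (Q : formula RS) (G' : graph L),
  valid (vc s Q) -> sat G (wp s Q) -> o = OGraph G' -> sat G' Q.
Proof.
elim=> {s G o}.
- by move=> G Q G' _ hQ [<-].
- move=> s0 s1 G G1 o _ IH0 _ IH1 Q G' hvc hwp; apply: IH1.
  + by move=> H; case: (hvc H).
  + by apply: (IH0 _ _ _ hwp) => // H; case: (hvc H).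
- move=> s0 s1 G o _ IH Q G' hvc [hwp _].
  by apply: IH hwp => H; case: (hvc H).
- move=> s0 s1 G o _ IH Q G' hvc [_ hwp].
  by apply: IH hwp => H; case: (hvc H).
- by move=> s inv G nA Q G' hvc hinv [<-]; case: (hvc G) => _ [_]; apply.
- move=> s inv G G1 o hA _ IHs _ IHstar Q G' hvc hinv; apply: IHstar => //=.
  (* The rest of the loop only needs [inv] at [G1], so the body is run with postcondition [inv]. *)
  apply: (IHs inv) => // [H|]; first by case: (hvc H).
  by case: (hvc G) => _ [hstep _]; apply: hstep.
- by move=> rho G G1 hA hs Q G' _ hwp [<-]; apply: sat_wp_fire hs (hwp hA).
(* The outcome [OTop] is not a graph. *)
- by [].
- by move=> rho G G1 _ hs Q G' _ [_ hwp] [<-]; apply: sat_wp_fire hs hwp.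
- by move=> rho G G1 hA hs Q G' _ [hwp _] [<-]; apply: sat_wp_fire hs (hwp hA).
- by move=> rho G nA Q G' _ [_ hQ] [<-]; apply: hQ.
Qed.

Theorem mainTheorem2 (L : logic) (SP : specification L) :
  valid (correct SP) ->
  forall G G' : graph L,
    exec (strat SP) G (OGraph G') -> sat G (pre SP) -> sat G' (post SP).
Proof.
move=> hcorrect G G' hexec hpre.
apply: (sat_wp_exec _ _ _ _ _ hexec) => // [H|].
- by case: (hcorrect H).
- by case: (hcorrect G) => hwp _; apply: hwp.
Qed.
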